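(* Let $(E,E^1)$ and $(E,E^2)$ be two complete dual pairs with the same underlying vector space $E$. Then the following statements are equivalent: (1) they have the same bounded sets; (2) they have the same smooth curves; (3) they have the same real analytic curves.
   Context: A dual pair $(E,E')$ is a real vector space $E$ together with a linear subspace $E'$ of its algebraic dual which separates points of $E$. A set $B\subseteq E$ is bounded if $\lambda(B)$ is bounded in $\mathbb R$ for all $\lambda\in E'$. For a bounded absolutely convex set $A$ let $E_A$ be the linear span of $A$ normed by the Minkowski functional of $A$. The dual pair is complete if every bounded set is contained in a bounded absolutely convex set $A$ such that $E_A$ is a Banach space. A curve $c:\mathbb R\to E$ is smooth (resp. real analytic) if $\lambda\circ c:\mathbb R\to\mathbb R$ is smooth (resp. real analytic) for all $\lambda\in E'$. *)

(* Defs.v *)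
From HB Require Import structures.
From mathcomp Require Import all_boot all_order all_algebra.
From mathcomp Require Import all_classical all_reals all_analysis.

Set Implicit Arguments.
Unset Strict Implicit.
Unset Printing Implicit Defensive.

Import Order.TTheory GRing.Theory Num.Theory.
Import numFieldNormedType.Exports.

Local Open Scope classical_set_scope.
Local Open Scope ring_scope.

(* [R^o], rather than [R], makes [E -> R^o] a left module; [dual_submod] and
   [dual_scalar] then say that [dual] is a subspace of the algebraic dual. *)
Record dual_pair (R : realType) (E : lmodType R) := DualPair {
  dual : set (E -> R^o);
  dual_scalar : forall l, dual l -> scalar l;
  dual_submod : GRing.submod_closed (mem dual);
  dual_separates : forall x y, x <> y -> exists2 l, dual l & l x <> l y }.

Section definitions.
Context {R : realType} {E : lmodType R}.
Implicit Types (D : dual_pair E) (A B : set E) (c : R -> E) (f : R -> R).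

Definition dual_bounded D B :=
  forall l, dual D l -> bounded_set (l @` B : set R^o).

Definition absolutely_convex A :=
  forall (x y : E) (a b : R), A x -> A y -> `|a| + `|b| <= 1 ->
  A (a *: x + b *: y).

Definition linear_span A : set E :=
  smallest [set S : set E | GRing.submod_closed (mem S)] A.

Definition minkowski_functional A (x : E) : R :=
  inf [set t | 0 < t /\ exists2 a, A a & x = t *: a].

Definition smooth_function f :=
  forall (n : nat) (x : R), derivable (derive1n n f) x 1.

Definition real_analytic_function f :=
  forall x : R, exists2 r : R, 0 < r & exists a : nat -> R, forall y : R,
  `|y - x| < r -> series (fun n => a n * (y - x) ^+ n) @ \oo --> f y.

Definition smooth_curve D c := forall l, dual D l -> smooth_function (l \o c).

Definition real_analytic_curve D c :=
  forall l, dual D l -> real_analytic_function (l \o c).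

End definitions.

Record bounded_disk (R : realType) (E : lmodType R) (D : dual_pair E) :=
  BoundedDisk {
  disk_set :> set E;
  disk_bounded : dual_bounded D disk_set;
  disk_absolutely_convex : absolutely_convex disk_set }.

Section linear_span_theory.
Context {R : realType} {E : lmodType R}.
Implicit Types (A S : set E).

Lemma submod_closedP S : GRing.submod_closed (mem S) <->
  S 0 /\ forall a x y, S x -> S y -> S (a *: x + y).
Proof.
split=> [[S0 SD]|[S0 SD]]; split.
- exact: set_mem.
- by move=> a x y Sx Sy; apply/set_mem/SD; exact: mem_set.
- exact: mem_set.
- by move=> a x y /set_mem Sx /set_mem Sy; apply/mem_set/SD.
Qed.

Lemma linear_span_submod A : GRing.submod_closed (mem (linear_span A)).
Proof.
apply/submod_closedP; split=> [S [/submod_closedP[]]//|].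
move=> a x y Ax Ay S SA; have [/submod_closedP[_ SD] _] := SA.
by apply: SD; [exact: Ax|exact: Ay].
Qed.

End linear_span_theory.

Definition disk_span (R : realType) (E : lmodType R) (D : dual_pair E)
    (A : bounded_disk D) : Type :=
  {x : E | x \in linear_span A}.

HB.instance Definition _ (R : realType) (E : lmodType R) (D : dual_pair E)
  (A : bounded_disk D) := [isSub of disk_span A for @sval E _].
HB.instance Definition _ (R : realType) (E : lmodType R) (D : dual_pair E)
  (A : bounded_disk D) := [Choice of disk_span A by <:].
HB.instance Definition _ (R : realType) (E : lmodType R) (D : dual_pair E)
  (A : bounded_disk D) :=
  GRing.SubChoice_isSubLmodule.Build R E (mem (linear_span A)) (disk_span A)
    (GRing.subsemimod_closed_submod (linear_span_submod A)).

Section minkowski_functional_theory.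
Context {R : realType} {E : lmodType R}.
Implicit Types (A : set E) (x y : E) (t : R).

Let gauge A x : set R := [set t | 0 < t /\ exists2 a, A a & x = t *: a].

Lemma minkowski_functional_lb A x t :
  0 < t -> (exists2 a, A a & x = t *: a) -> minkowski_functional A x <= t.
Proof.
move=> t0 At; apply: ge_inf; last by split.
by exists 0 => u [/ltW].
Qed.

Lemma minkowski_functional_glb A x t : gauge A x !=set0 ->
  (forall u, 0 < u -> (exists2 a, A a & x = u *: a) -> t <= u) ->
  t <= minkowski_functional A x.
Proof. by move=> A0 tA; apply: lb_le_inf => // u [u0 Au]; exact: tA. Qed.

Lemma gauge_combination A x y (c s t : R) : absolutely_convex A ->
  gauge A x t -> gauge A y s -> gauge A (c *: x + y) (`|c| * t + s).
Proof.
move=> cA [t0 [a Aa ->]] [s0 [b Ab ->]].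
have u0 : 0 < `|c| * t + s by rewrite ltr_wpDl// mulr_ge0// ltW.
split => //; exists ((c * t / (`|c| * t + s)) *: a + (s / (`|c| * t + s)) *: b).
  apply: cA => //; rewrite !normrM normfV (gtr0_norm t0) (gtr0_norm s0).
  by rewrite (gtr0_norm u0) -mulrDl divff// gt_eqF.
rewrite scalerDr !scalerA; congr (_ *: _ + _ *: _).
  by rewrite mulrCA divff ?mulr1// gt_eqF.
by rewrite mulrCA divff ?mulr1// gt_eqF.
Qed.

Lemma linear_span_gauge A x : absolutely_convex A -> linear_span A x ->
  x = 0 \/ gauge A x !=set0.
Proof.
move=> cA /(_ [set y | y = 0 \/ gauge A y !=set0]); apply; split; last first.
  by move=> y Ay; right; exists 1; split => //; exists y; rewrite ?scale1r.
apply/submod_closedP; split; first by left.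
move=> c y z [->|[t yt]] [->|[s zs]].
- by left; rewrite scaler0 addr0.
- by right; exists s; rewrite scaler0 add0r.
- right; exists (`|c| * t + t).
  have [t0 [a Aa _]] := yt; suff : gauge A 0 t by exact: gauge_combination.
  split=> //; exists 0; rewrite ?scaler0//.
  have := cA a a 0 0 Aa Aa; rewrite !scale0r addr0; apply.
  by rewrite normr0 addr0 ler01.
- by right; exists (`|c| * t + s); exact: gauge_combination.
Qed.

Lemma minkowski_functional0 A : absolutely_convex A ->
  minkowski_functional A 0 = 0.
Proof.
move=> cA; have [->|/set0P[a Aa]] := eqVneq A set0.
  by rewrite /minkowski_functional -[RHS](inf0 R); congr inf;
    apply/seteqP; split=> // t [_ []].
have A0 : A 0.
  have := cA a a 0 0 Aa Aa; rewrite !scale0r addr0; apply.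
  by rewrite normr0 addr0 ler01.
apply/eqP; rewrite eq_le; apply/andP; split.
  apply/ler_addgt0Pl => e e0; rewrite addr0.
  by apply: minkowski_functional_lb => //; exists 0; rewrite ?scaler0.
apply: minkowski_functional_glb => [|u /ltW//].
by exists 1; split => //; exists 0; rewrite ?scaler0.
Qed.

Lemma minkowski_functionalD A x y : absolutely_convex A ->
  linear_span A x -> linear_span A y ->
  minkowski_functional A (x + y) <=
  minkowski_functional A x + minkowski_functional A y.
Proof.
move=> cA sx sy.
have [->|gx] := linear_span_gauge cA sx.
  by rewrite minkowski_functional0// !add0r.
have [->|gy] := linear_span_gauge cA sy.
  by rewrite minkowski_functional0// !addr0.
rewrite -lerBlDr; apply: minkowski_functional_glb => // t t0 At.
rewrite lerBlDl -lerBlDr; apply: minkowski_functional_glb => // s s0 As.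
have [u0 Au] : gauge A (1 *: x + y) (`|1| * t + s) by exact: gauge_combination.
rewrite scale1r normr1 mul1r in u0 Au; rewrite lerBlDl.
exact: minkowski_functional_lb.
Qed.

Let minkowski_functionalZ_le A x (l : R) : absolutely_convex A ->
  linear_span A x -> l != 0 ->
  minkowski_functional A (l *: x) <= `|l| * minkowski_functional A x.
Proof.
move=> cA sx l0; have [->|gx] := linear_span_gauge cA sx.
  by rewrite scaler0 minkowski_functional0// mulr0.
have nl0 : 0 < `|l| by rewrite normr_gt0.
rewrite -ler_pdivrMl//; apply: minkowski_functional_glb => // t t0 [a Aa ->].
rewrite ler_pdivrMl//; apply: minkowski_functional_lb; first exact: mulr_gt0.
exists ((l / `|l|) *: a).
  have := cA a a (l / `|l|) 0 Aa Aa; rewrite scale0r addr0; apply.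
  by rewrite normrM normfV normr_id divff ?gt_eqF// normr0 addr0.
rewrite !scalerA; congr (_ *: _).
by rewrite [RHS]mulrC mulrA divfK// gt_eqF.
Qed.

Lemma minkowski_functionalZ A x (l : R) : absolutely_convex A ->
  linear_span A x ->
  minkowski_functional A (l *: x) = `|l| * minkowski_functional A x.
Proof.
move=> cA sx; have [->|l0] := eqVneq l 0.
  by rewrite scale0r normr0 mul0r minkowski_functional0.
apply/eqP; rewrite eq_le minkowski_functionalZ_le//= -ler_pdivlMl ?normr_gt0//.
rewrite -normfV -[in leLHS](scalerK l0 x) minkowski_functionalZ_le ?invr_eq0//.
have /submod_closedP[S0 SD] := linear_span_submod A.
by rewrite -[l *: x]addr0; exact: SD.
Qed.

Lemma minkowski_functional_eq0 (D : dual_pair E) A x :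
  dual_bounded D A -> absolutely_convex A -> linear_span A x ->
  minkowski_functional A x = 0 -> x = 0.
Proof.
move=> bA cA sx px0; apply: contrapT => /(@dual_separates _ _ D)[l Dl]; apply.
have lD := dual_scalar Dl.
have lZ (c : R) z : l (c *: z) = c * l z.
  have l0 : l 0 = 0.
    by have /eqP := lD 1 0 0; rewrite scaler0 addr0 mul1r -subr_eq subrr => /eqP.
  by have := lD c z 0; rewrite l0 !addr0.
have -> : l 0 = 0 by rewrite -(scale0r 0) lZ mul0r.
have [->|gx] := linear_span_gauge cA sx; first by rewrite -(scale0r 0) lZ mul0r.
have [M [_ lM]] := bA l Dl.
pose K := `|M| + 1.
have K0 : 0 < K by rewrite ltr_pwDr.
have lA a : A a -> `|l a| <= K.
  move=> Aa; apply: (lM K); last by exists a.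
  by rewrite (le_lt_trans (ler_norm M))// ltrDl.
apply/eqP; rewrite -normr_eq0 eq_le normr_ge0 andbT.
suff : `|l x| / K <= 0 by rewrite ler_pdivrMr// mul0r.
rewrite -px0; apply: minkowski_functional_glb => // t t0 [a Aa ->].
by rewrite lZ normrM (gtr0_norm t0) ler_pdivrMr// ler_wpM2l ?lA// ltW.
Qed.

End minkowski_functional_theory.

Section disk_span_norm.
Context (R : realType) (E : lmodType R) (D : dual_pair E) (A : bounded_disk D).
Implicit Types x y : disk_span A.

Let norm x : R := minkowski_functional A (val x).

Let diskA : absolutely_convex A := @disk_absolutely_convex _ _ _ A.

Let spanP x : linear_span A (val x).
Proof. exact: set_mem (valP x). Qed.

Let normD x y : norm (x + y) <= norm x + norm y.
Proof.
rewrite /norm raddfD.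
exact: minkowski_functionalD diskA (spanP x) (spanP y).
Qed.

Let normZ (l : R) x : norm (l *: x) = `|l| * norm x.
Proof.
rewrite /norm linearZ.
exact: minkowski_functionalZ diskA (spanP x).
Qed.

Let norm0_eq0 x : norm x = 0 -> x = 0.
Proof.
move=> x0; apply: val_inj; rewrite raddf0.
exact: minkowski_functional_eq0 (@disk_bounded _ _ _ A)
  diskA (spanP x) x0.
Qed.

HB.instance Definition _ :=
  Lmodule_isNormed.Build R (disk_span A) normD normZ norm0_eq0.

Lemma disk_span_normE x : `|x| = minkowski_functional A (val x).
Proof. by []. Qed.

End disk_span_norm.

(* The completeness axiom of [completeNormedModType], for the normed module
   [disk_span A]. *)
Definition banach_disk (R : realType) (E : lmodType R) (D : dual_pair E)
    (A : bounded_disk D) :=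
  forall F : set_system (disk_span A), ProperFilter F -> cauchy F -> cvg F.

Definition complete_dual_pair (R : realType) (E : lmodType R)
    (D : dual_pair E) :=
  forall B : set E, dual_bounded D B ->
  exists2 A : bounded_disk D, B `<=` A & banach_disk A.

(* Main.v *)
Require Import Defs.
From mathcomp Require Import all_boot all_order all_algebra.
From mathcomp Require Import all_classical all_reals all_analysis.
From mathcomp Require Import ring lra.

(* A linear functional that is bounded on bounded sets preserves smoothness: by
   Taylor's formula the difference quotients of a smooth curve are Mackey-Cauchy,
   so by completeness they converge in some Banach space [E_A], and the derivative
   is again a smooth curve.  It preserves real analyticity because real analytic
   functions are the smooth functions that satisfy local Cauchy estimates.
   Conversely, if [l] is unbounded on a bounded set, then a Banach disk contains
   [x_n] for which the Newton series [sum_n x_n / n! prod_(j < n) (t - 1 / (j + 1))]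
   is a real analytic curve whose composite with [l] is at least [k] at
   [1 / (k + 1)]. *)

Set Implicit Arguments.
Unset Strict Implicit.
Unset Printing Implicit Defensive.

Import Order.TTheory GRing.Theory Num.Theory.
Import numFieldNormedType.Exports.

Local Open Scope classical_set_scope.
Local Open Scope ring_scope.

(** * Taylor estimates for smooth functions of a real variable *)

Section scalar_functions.
Context {R : realType}.
Implicit Types (f g : R -> R) (x y h : R).

Lemma le_mono_derive (g dg : R -> R) (a b : R) :
  (forall x, is_derive x 1 g (dg x)) ->
  (forall x, a <= x <= b -> 0 <= dg x) -> a <= b -> g a <= g b.
Proof.
move=> gd dg0 ab; apply: (@ger0_derive1_ndecr _ g a b) => //.
- move=> x; rewrite in_itv/= => /andP[ax xb].
  by rewrite derive1E; have [_ ->] := gd x; rewrite dg0// !ltW.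
- by apply: derivable_within_continuous => x _; have [] := gd x.
Qed.

Lemma is_derive_monomial (M : R) n x :
  is_derive x 1 (fun t => M / n.+1%:R * t ^+ n.+1) (M * x ^+ n).
Proof.
have := @is_derive_poly _ ((M / n.+1%:R) *: 'X^(n.+1)) x.
rewrite derivZ derivXn hornerZ hornerMn hornerXn -(mulr_natl (x ^+ n)) mulrA.
have -> : horner (M / n.+1%:R *: 'X^(n.+1)) =
    (fun t => M / n.+1%:R * t ^+ n.+1).
  by apply/funext => t; rewrite hornerZ hornerXn.
by rewrite divfK// pnatr_eq0.
Qed.

(** Monotonicity stands in for integration: on [[0, d]] the difference between the monomial and [g]
    is nondecreasing and vanishes at 0. Applying this to [- g] and to the reflection of [g] at 0
    gives the two-sided bound. *)
Lemma norm_le_monomial_derive (g dg : R -> R) (M d : R) n :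
  (forall x, is_derive x 1 g (dg x)) -> g 0 = 0 ->
  (forall t : R, `|t| <= d -> `|dg t| <= M * `|t| ^+ n) ->
  forall t : R, `|t| <= d -> `|g t| <= M / n.+1%:R * `|t| ^+ n.+1.
Proof.
have pos (g1 dg1 : R -> R) : (forall x, is_derive x 1 g1 (dg1 x)) -> g1 0 = 0 ->
    (forall t : R, `|t| <= d -> `|dg1 t| <= M * `|t| ^+ n) ->
    forall t : R, 0 <= t <= d -> g1 t <= M / n.+1%:R * t ^+ n.+1.
  move=> gd g0 dgM t /andP[t0 td]; rewrite -subr_ge0.
  pose k (s : R) := M / n.+1%:R * s ^+ n.+1 - g1 s.
  have kd y : is_derive y 1 k (M * y ^+ n - dg1 y).
    by apply: is_deriveB; exact: is_derive_monomial.
  have k0 : k 0 = 0 by rewrite /k g0 expr0n/= mulr0 subrr.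
  rewrite -k0 -[leRHS]/(k t).
  apply: (le_mono_derive kd) => // s /andP[s0 st].
  rewrite subr_ge0; apply: le_trans (ler_norm _) _.
  have := dgM s; rewrite (ger0_norm s0); apply.
  exact: le_trans td.
have half (g1 dg1 : R -> R) : (forall x, is_derive x 1 g1 (dg1 x)) -> g1 0 = 0 ->
    (forall t : R, `|t| <= d -> `|dg1 t| <= M * `|t| ^+ n) ->
    forall t : R, 0 <= t <= d -> `|g1 t| <= M / n.+1%:R * `|t| ^+ n.+1.
  move=> gd g0 dgM t td; have /andP[t0 _] := td.
  rewrite ler_norml (ger0_norm t0) lerNl (pos _ _ gd)// andbT.
  apply: (pos (- g1) (- dg1)) => //; first by rewrite !fctE g0 oppr0.
  by move=> s sd; rewrite !fctE normrN; exact: dgM.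
move=> gd g0 dgM t td; have [t0|t0] := leP 0 t.
  by apply: half gd g0 dgM _ _; rewrite t0 -(ger0_norm t0).
have gNd y : is_derive y 1 (g \o -%R) (dg (- y) * - 1).
  by apply: is_derive1_comp; exact: gd.
have := half _ _ gNd; rewrite /= oppr0 => /(_ g0) H.
rewrite -[t]opprK [in leRHS]normrN; apply: H.
  by move=> s sd; rewrite mulrN1 normrN -[`|s|]normrN dgM// normrN.
by rewrite oppr_ge0 ltW//= -(ltr0_norm t0).
Qed.

(** A polynomial in the increment [h], to be compared with [f (x + h)]; its degree is below [n], so
    that the remainder has order [n]. *)
Definition taylor_poly f n x : {poly R} := \poly_(k < n) ((derive1n k f) x / k`!%:R).

Lemma smooth_derivable f x : smooth_function f -> derivable f x 1.
Proof. by move=> sf; exact: (sf 0%N). Qed.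

Lemma smooth_derive1 f : smooth_function f -> smooth_function (derive1 f).
Proof. by move=> sf n x; rewrite -derive1Sn; exact: sf. Qed.

Lemma deriv_taylor_poly f n x :
  (taylor_poly f n.+1 x)^`() = taylor_poly (derive1 f) n x.
Proof.
apply/polyP => k; rewrite coef_deriv !coef_poly ltnS; case: ifP; last first.
  by rewrite mul0rn.
move=> _; rewrite -derive1Sn factS natrM -(mulr_natr (_ / _)) invfM -!mulrA; congr (_ * _).
by rewrite mulrCA mulVf ?mulr1 ?pnatr_eq0.
Qed.

(** Induction on [n] with [f] general: the derivative in [h] of the remainder of order [n + 1] is
    the remainder of order [n] of [derive1 f], and the bound is integrated from 0, where the
    remainder vanishes. *)
Lemma taylor_remainder f (M d : R) n x : smooth_function f ->
  (forall h, `|h| <= d -> `|(derive1n n f) (x + h)| <= M) ->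
  forall h, `|h| <= d ->
  `|f (x + h) - (taylor_poly f n x).[h]| <= M / n`!%:R * `|h| ^+ n.
Proof.
elim: n f => [|n IH] f sf fM h hd.
  by rewrite /taylor_poly poly_def big_ord0 horner0 subr0 expr0 invr1 !mulr1 fM.
have fd y : is_derive y 1 f (derive1 f y).
  by rewrite derive1E; apply/derivableP; exact: smooth_derivable.
pose g (t : R) : R := f (x + t) - (taylor_poly f n.+1 x).[t].
have gd (t : R) : is_derive t 1 g (derive1 f (x + t) - (taylor_poly (derive1 f) n x).[t]).
  rewrite -deriv_taylor_poly.
  have -> : g = (f \o +%R x) - horner (taylor_poly f n.+1 x) by apply/funext.
  apply: is_deriveB.
  rewrite -[derive1 f _]mulr1; apply: is_derive1_comp.
  have -> : +%R x = shift x :> (R -> R) by apply/funext => s; rewrite addrC.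
  exact: is_derive_shift.
have := norm_le_monomial_derive gd _ _ hd.
rewrite factS natrM invfM mulrCA [_^-1 * _]mulrC; apply.
  rewrite /g addr0 horner_coef0 coef_poly/= invr1 mulr1.
  exact: subrr.
move=> t td; apply: (IH _ (smooth_derive1 sf) _ _ td) => s sd.
by rewrite -derive1Sn; exact: fM.
Qed.

Lemma smooth_bounded f (a b : R) : smooth_function f ->
  exists M : R, forall x, a <= x <= b -> `|f x| <= M.
Proof.
move=> sf; have [ab|ba] := leP a b; last first.
  by exists 0 => x /andP[/le_trans /[apply]]; rewrite leNgt ba.
have cf : {within `[a, b], continuous (fun x => `|f x|)}.
  apply: continuous_subspaceT => x; apply: cvg_norm.
  exact/differentiable_continuous/derivable1_diffP/smooth_derivable.
have [c _ fc] := EVT_max ab cf.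
by exists `|f c| => x xab; apply: fc; rewrite in_itv.
Qed.

Lemma smooth_taylor2 f x : smooth_function f -> exists M : R, forall h, `|h| <= 1 ->
  `|f (x + h) - f x - derive1 f x * h| <= M * `|h| ^+ 2.
Proof.
move=> sf.
have [M fM] := @smooth_bounded (derive1n 2 f) (x - 1) (x + 1)
  (smooth_derive1 (smooth_derive1 sf)).
exists (M / 2) => h h1.
have -> : f (x + h) - f x - derive1 f x * h =
    f (x + h) - (taylor_poly f 2 x).[h].
  rewrite /taylor_poly poly_def !big_ord_recr big_ord0/= add0r !hornerE.
  by rewrite !invr1 !mulr1 opprD addrA.
apply: (@taylor_remainder f M 1 2 x sf _ h h1).
by move=> s; rewrite ler_norml => /andP[s1 s2]; apply: fM; rewrite !lerD2l s1.
Qed.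

End scalar_functions.

(** * Power series and Cauchy estimates for real analytic functions *)

Section power_series.
Context {R : realType}.
Implicit Types (a b : nat -> R) (f : R -> R) (x h s t C K : R).

Lemma norm_pseries_le b C t h n : (forall i, `|b i| <= C * t ^+ i) ->
  t * `|h| < 1 -> 0 <= t -> `|pseries b h n| <= C / (1 - t * `|h|).
Proof.
move=> bC th1 t0; rewrite /pseries /series/=.
have C0 : 0 <= C by have := bC 0%N; rewrite expr0 mulr1; exact: le_trans.
have th0 : 0 <= t * `|h| by rewrite mulr_ge0.
apply: (@le_trans _ _ (series (geometric C (t * `|h|)) n)).
  rewrite /series/=; apply: le_trans (ler_norm_sum _ _ _) _.
  apply: ler_sum => i _; rewrite normrM normrX exprMn mulrA.
  by apply: ler_wpM2r => //; rewrite exprn_ge0.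
rewrite geometric_seriesE ?lt_eqF//.
rewrite ler_pM2r ?invr_gt0 ?subr_gt0// ler_piMr//.
by rewrite lerBlDr lerDl exprn_ge0.
Qed.

Lemma is_cvg_pseries_geometric b C t h : (forall i, `|b i| <= C * t ^+ i) ->
  t * `|h| < 1 -> 0 <= t -> cvgn (pseries b h).
Proof.
move=> bC th1 t0.
have C0 : 0 <= C by have := bC 0%N; rewrite expr0 mulr1; exact: le_trans.
have th0 : 0 <= t * `|h| by rewrite mulr_ge0.
apply: normed_cvg; apply: (@series_le_cvg _ _ (geometric C (t * `|h|))).
- by move=> n; exact: normr_ge0.
- by move=> n; rewrite /geometric/= mulr_ge0// exprn_ge0.
- move=> n; rewrite /geometric/= normrM normrX exprMn mulrA.
  by apply: ler_wpM2r => //; rewrite exprn_ge0.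
- by apply: is_cvg_geometric_series; rewrite ger0_norm.
Qed.

Lemma norm_lim_pseries_le b C t h : (forall i, `|b i| <= C * t ^+ i) ->
  t * `|h| < 1 -> 0 <= t -> `|limn (pseries b h)| <= C / (1 - t * `|h|).
Proof.
move=> bC th1 t0; have cb := is_cvg_pseries_geometric bC th1 t0.
rewrite -lim_norm//; apply: limr_le; first exact: is_cvg_norm.
by apply: nearW => n; exact: norm_pseries_le.
Qed.

(** The factor is [(i + k)! / i!], produced by [k] differentiations; the binomial form isolates
    [k!], the growth allowed in a Cauchy estimate. *)
Lemma iter_pseries_diffs a k i :
  iter k (@pseries_diffs R) a i = (k`! * 'C(i + k, k))%:R * a (i + k)%N.
Proof.
elim: k i => [|k IH] i; first by rewrite addn0 bin0 mul1r.
rewrite iterS /pseries_diffs IH mulrA -natrM addSnnS; congr (_%:R * _).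
rewrite factS -mulnA mulnCA [in RHS]mulnA [(k.+1 * _)%N]mulnC -[in RHS]mulnA.
by rewrite mul_bin_left -addSnnS addnK.
Qed.

Lemma bin_le_expn2 n m : ('C(n, m) <= 2 ^ n)%N.
Proof.
elim: n m => [|n IH] [|m]; rewrite ?bin0 ?expn_gt0//.
by rewrite binS expnS mul2n -addnn leq_add.
Qed.

Lemma norm_iter_pseries_diffs a K s k i : 0 <= s ->
  (forall n, `|a n| <= K * s ^+ n) ->
  `|iter k (@pseries_diffs R) a i| <= K * (2 * s) ^+ k * k`!%:R * (2 * s) ^+ i.
Proof.
move=> s0 aK; rewrite iter_pseries_diffs normrM normr_nat natrM.
have -> : K * (2 * s) ^+ k * k`!%:R * (2 * s) ^+ i =
    (k`!%:R * 2 ^+ (i + k)) * (K * s ^+ (i + k)).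
  by rewrite !exprMn !exprD; ring.
apply: ler_pM => //.
by rewrite ler_wpM2l// -natrX ler_nat bin_le_expn2.
Qed.

(** Convergence at the single point [x + r / 2] bounds the terms there, whence geometric growth with
    ratio [s = 2 / r]. *)
Lemma real_analytic_coef f x : real_analytic_function f ->
  exists s K a, [/\ 0 < s, 0 < K, forall n, `|a n| <= K * s ^+ n &
    forall h, s * `|h| < 1 -> f (x + h) = limn (pseries a h)].
Proof.
move=> /(_ x)[r r0 [a af]].
have r20 : 0 < r / 2 by rewrite divr_gt0.
have /cvg_series_bounded[M [_ aM]] : cvgn (pseries a (r / 2)).
  apply/cvg_ex; exists (f (x + r / 2)).
  have := af (x + r / 2); rewrite addrAC subrr add0r; apply.
  by rewrite gtr0_norm// ltr_pdivrMr// ltr_pMr// ltr1n.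
exists (r / 2)^-1, (`|M| + 1), a; split.
- by rewrite invr_gt0.
- by rewrite ltr_wpDl.
- move=> n; have := aM (`|M| + 1) _ n Logic.I.
  rewrite (le_lt_trans (ler_norm M)) ?ltrDl// => /(_ isT)/=.
  rewrite normrM exprVn ler_pdivlMr ?exprn_gt0//.
  by rewrite normrX (gtr0_norm r20).
- move=> h; rewrite mulrC ltr_pdivrMr// mul1r => hr.
  apply/esym/cvg_lim => //; have := af (x + h); rewrite addrAC subrr add0r.
  by apply; apply: (lt_le_trans hr); rewrite ler_pdivrMr// ler_pMr// ler1n.
Qed.

(* [2 s] because ['C(i + k, k) <= 2 ^ (i + k)]: all the derived series converge
   on one common disk. *)
Lemma is_derive_pseries f x s K a : 0 < s ->
  (forall n, `|a n| <= K * s ^+ n) ->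
  (forall h, s * `|h| < 1 -> f (x + h) = limn (pseries a h)) ->
  forall k h, 2 * s * `|h| < 1 ->
  is_derive (x + h) (1 : R) (derive1n k f)
    (limn (pseries (iter k.+1 (@pseries_diffs R) a) h)) /\
  derive1n k f (x + h) = limn (pseries (iter k (@pseries_diffs R) a) h).
Proof.
move=> s0 aK fa.
have s20 : 0 < 2 * s by rewrite mulr_gt0.
pose F k := fun h => limn (pseries (iter k (@pseries_diffs R) a) h).
have cF k h : 2 * s * `|h| < 1 ->
    cvgn (pseries (iter k (@pseries_diffs R) a) h).
  move=> h1; apply: is_cvg_pseries_geometric (ltW s20) => // i.
  exact: norm_iter_pseries_diffs (ltW s0) aK.
have dF k h : 2 * s * `|h| < 1 -> is_derive h 1 (F k) (F k.+1 h).
  (* The midpoint of [|h|] and [1 / (2 * s)]: termwise differentiation at [h] asks for convergence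
     of the series and its first two derived series at a point farther out. *)
  move=> h1; pose K0 := (`|h| + (2 * s)^-1) / 2.
  have hs : `|h| < (2 * s)^-1 by rewrite -div1r ltr_pdivlMr// mulrC.
  have K00 : 0 <= K0 by rewrite divr_ge0// addr_ge0// invr_ge0 ltW.
  have K0s : 2 * s * `|K0| < 1.
    rewrite mulrC -ltr_pdivlMr// div1r ger0_norm// /K0 ltr_pdivrMr//; lra.
  apply: (@pseries_snd_diffs _ _ K0); [exact: cF|exact: (cF k.+1)|
    exact: (cF k.+2)|].
  by rewrite (ger0_norm K00) /K0 ltr_pdivlMr//; lra.
have step k : (forall h, 2 * s * `|h| < 1 -> derive1n k f (x + h) = F k h) ->
    forall h, 2 * s * `|h| < 1 ->
    is_derive (x + h) (1 : R) (derive1n k f) (F k.+1 h).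
  move=> fF h h1.
  (* The condition on [h] is open, so the two functions agree near [x + h] and share their
     derivative. *)
  have e : \forall y \near (x + h), (F k \o shift (- x)) y = derive1n k f y.
    near=> y; rewrite /= -fF; first by rewrite addrC subrK.
    rewrite mulrC -ltr_pdivlMr//; near: y.
    have : `|y - x| @[y --> x + h] --> `|x + h - x|.
      by apply: cvg_norm; apply: cvgB => //; exact: cvg_cst.
    move/cvgr_lt; apply; rewrite addrAC subrr add0r ltr_pdivlMr//.
    by rewrite mulrC.
  have d : is_derive (x + h) (1 : R) (F k \o shift (- x)) (F k.+1 h).
    rewrite -[F k.+1 h]mulr1; apply: is_derive1_comp.
    by rewrite /= addrAC subrr add0r; exact: dF.
    exact: is_derive_shift.
  
  exact: near_eq_is_derive e d.
have fF k : forall h, 2 * s * `|h| < 1 -> derive1n k f (x + h) = F k h.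
  elim: k => [|k IH] h h1.
    apply: fa; apply: le_lt_trans h1; rewrite ler_wpM2r// ler_peMl ?ler1n//.
    exact: ltW.
  by rewrite derive1nS derive1E; have [_ ->] := step _ IH _ h1.
by move=> k h h1; split; [exact: (step k (fF k))|exact: fF].
Unshelve. all: by end_near. Qed.

Lemma real_analytic_smooth f : real_analytic_function f -> smooth_function f.
Proof.
move=> af n x; have [s [K [a [s0 _ aK fa]]]] := real_analytic_coef x af.
have [] := is_derive_pseries s0 aK fa n (h := 0).
  by rewrite normr0 mulr0.
by rewrite addr0 => -[].
Qed.

(** A single constant serves as prefactor and as growth ratio, hence the exponent [n + 1]. *)
Definition cauchy_estimate f x (C d : R) :=
  forall n y, `|y - x| < d -> `|derive1n n f y| <= C ^+ n.+1 * n`!%:R.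

Lemma real_analytic_cauchy_estimate f x : real_analytic_function f ->
  exists C, exists2 d, 0 < d & cauchy_estimate f x C d.
Proof.
move=> af; have [s [K [a [s0 K0 aK fa]]]] := real_analytic_coef x af.
have s20 : 0 < 2 * s by rewrite mulr_gt0.
(* On the ball of radius [1 / (4 * s)] the ratio [2 * s * |y - x|] is below 1/2, so the geometric
   series costs at most a factor 2, absorbed by [2 * K]; the summand [2 * s] dominates the growth
   ratio. *)
pose C := 2 * K + 2 * s.
exists C, (4 * s)^-1; first by rewrite invr_gt0 mulr_gt0.
move=> n y; rewrite -[(4 * s)^-1]div1r ltr_pdivlMr ?mulr_gt0// => yx.
have h1 : 2 * s * `|y - x| < 1 / 2 by lra.
have h2 : 2 * s * `|y - x| < 1 by lra.
have [_] := is_derive_pseries s0 aK fa n h2; rewrite addrC subrK => ->.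
apply: le_trans.
  apply: (norm_lim_pseries_le _ h2 (ltW s20)) => i.
  exact: norm_iter_pseries_diffs (ltW s0) aK.
rewrite ler_pdivrMr ?subr_gt0//.
have CK : 2 * K <= C by rewrite lerDl ltW.
have Cs : (2 * s) ^+ n <= C ^+ n.
  by rewrite lerXn2r ?nnegrE ?ltW// ?addr_gt0 ?mulr_gt0// ltrDr mulr_gt0.
rewrite exprS.
have := ler_wpM2l (ltW K0) Cs => KC.
apply: (@le_trans _ _ (K * C ^+ n * n`!%:R)); first by rewrite ler_wpM2r.
have Cn : 0 <= C ^+ n by rewrite exprn_ge0// addr_ge0// mulr_ge0// ltW.
set u := 2 * s * _ in h1 h2 *.
have -> : C * C ^+ n * n`!%:R * (1 - u) = C * (1 - u) * C ^+ n * n`!%:R by ring.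
rewrite !ler_wpM2r//; nra.
Qed.

End power_series.

(** * Sufficient criteria for real analyticity *)

Section analytic_criteria.
Context {R : realType}.
Implicit Types (a b : nat -> R) (f : R -> R) (x h s t C M : R).

Lemma cvg_geometric_bound (u : nat -> R) l C t : `|t| < 1 ->
  (forall n, `|l - u n| <= C * t ^+ n) -> u @ \oo --> l.
Proof.
move=> t1 lu; apply/cvgrPdist_lt => e e0.
have /cvgr0Pnorm_lt/(_ e e0) := cvg_geometric C t1.
by apply: filterS => n; apply: le_lt_trans; exact: le_trans (ler_norm _).
Qed.

(** The [n!] of the estimate cancels that of the Taylor remainder, which is then at most
    [C * (C * |h|) ^ n]. *)
Lemma cauchy_estimate_real_analytic f : smooth_function f ->
  (forall x, exists C, exists2 d, 0 < d & cauchy_estimate f x C d) ->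
  real_analytic_function f.
Proof.
move=> sf fC x; have [C [d d0 fx]] := fC x.
have C0 : 0 <= C.
  have := fx 0%N x; rewrite subrr normr0 => /(_ d0).
  by rewrite expr1 mulr1; exact: le_trans.
(* [C + 1] rather than [C] keeps the radius positive when [C = 0]. *)
exists (Num.min d (C + 1)^-1); first by rewrite lt_min d0 invr_gt0 ltr_wpDl.
exists (fun n => derive1n n f x / n`!%:R) => y; rewrite lt_min => /andP[yd yC].
pose h := y - x.
have hC : C * `|h| < 1.
  move: yC; rewrite -[_^-1]div1r ltr_pdivlMr ?ltr_wpDl// -/h mulrDr mulr1.
  by rewrite mulrC; apply: le_lt_trans; rewrite lerDl.
apply: (@cvg_geometric_bound _ _ C (C * `|h|)).
  by rewrite ger0_norm ?mulr_ge0.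
move=> n; have -> : series (fun i => derive1n i f x / i`!%:R * (y - x) ^+ i) n =
    (taylor_poly f n x).[h].
  rewrite /series/= /taylor_poly horner_poly big_mkord.
  by apply: eq_bigr.
have -> : f y = f (x + h) by rewrite /h addrC subrK.
apply: le_trans (@taylor_remainder _ f (C ^+ n.+1 * n`!%:R) `|h| n x sf _ h _) _.
- move=> s sh; apply: fx; rewrite addrAC subrr add0r.
  exact: le_lt_trans yd.
- by [].
- by rewrite mulfK ?pnatr_eq0 ?gtn_eqF ?fact_gt0// exprS exprMn mulrA.
Qed.

(** The part of [(P N).[h]] of degree at least [K] is bounded by [C / (1 - |h|) * |h| ^ K],
    uniformly in [N]; letting [N] grow turns this into a rate for the partial sums of the limit
    series. *)
Lemma cvg_poly_cvg_pseries (P : nat -> {poly R}) a C h (l : R) :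
  (forall N k, `|(P N)`_k| <= C) -> (forall k, (fun N => (P N)`_k : R) @ \oo --> a k) ->
  `|h| < 1 -> (P N).[h] @[N --> \oo] --> l -> pseries a h @ \oo --> l.
Proof.
move=> PC Pa h1 Pl.
apply: (@cvg_geometric_bound _ _ (C / (1 - `|h|)) `|h|).
  by rewrite normr_id.
have Pa_sum K : pseries (fun k => (P N)`_k) h K @[N --> \oo] -->
    pseries a h K.
  rewrite /pseries /series/=; elim: K => [|K IH].
    under [X in X @ _ --> _]eq_fun do rewrite big_nil.
    by rewrite big_nil; exact: cvg_cst.
  under [X in X @ _ --> _]eq_fun do rewrite big_nat_recr//=.
  by rewrite big_nat_recr//=; apply: cvgD => //; exact: cvgMl.
move=> K; have PK : (P N).[h] - pseries (fun k => (P N)`_k) h K @[N --> \oo] -->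
    l - pseries a h K by apply: cvgB; [exact: Pl|exact: Pa_sum].
apply: (cvgr_to_le (cvg_norm PK)); apply: nearW => N.
rewrite -{1}(poly_take_drop K (P N)) hornerD hornerM hornerXn.
have -> : (take_poly K (P N)).[h] = pseries (fun k => (P N)`_k) h K.
  by rewrite /take_poly horner_poly /pseries /series/= big_mkord.
rewrite addrAC subrr add0r normrM normrX ler_wpM2r// ?exprn_ge0//.
rewrite horner_coef.
have -> : \sum_(i < size (drop_poly K (P N))) (drop_poly K (P N))`_i * h ^+ i =
   pseries (fun k => (drop_poly K (P N))`_k) h (size (drop_poly K (P N))).
  by rewrite /pseries /series/= big_mkord.
rewrite -[`|h| in leRHS]mul1r; apply: norm_pseries_le; rewrite ?mul1r// => i.
by rewrite expr1n mulr1 coef_drop_poly.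
Qed.

(** Each new factor enlarges the greatest coefficient at most [M + 1] times: [M] from the constant,
    1 from the shift by ['X]. *)
Lemma norm_coef_prod_XaddC (u : nat -> R) M n k : (forall j, `|u j| <= M) ->
  `|(\prod_(j < n) ('X + (u j)%:P))`_k| <= (M + 1) ^+ n.
Proof.
move=> uM; have M0 : 0 <= M by apply: le_trans (uM 0%N).
elim: n k => [|n IH] k.
  by rewrite big_ord0 coef1; case: (k == 0%N); rewrite ?normr1 ?normr0 ?expr0.
rewrite big_ord_recr/= mulrDr coefD coefMX coefMC exprSr mulrDr mulr1 addrC.
apply: le_trans (ler_normD _ _) _; rewrite lerD//.
  by rewrite normrM ler_pM.
by case: eqP => _ //; rewrite normr0 exprn_ge0// addr_ge0.
Qed.

(** Expanded in powers of [h = z - x], the [n]-th term has coefficients at most [M * G ^ n / n!],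
    which is summable. So the coefficients of the partial sums converge and stay bounded, which
    gives an expansion on the unit ball around every [x]. *)
Lemma newton_series_real_analytic (t y : nat -> R) M f :
  (forall n, `|t n| <= 1) -> (forall n, `|y n| <= M) ->
  (forall x, series (fun n => y n / n`!%:R * \prod_(j < n) (x - t j)) @ \oo -->
     f x) ->
  real_analytic_function f.
Proof.
move=> t1 yM fx x; exists 1 => //.
pose q n := \prod_(j < n) ('X + (x - t j)%:P).
(* [|x| + 1] bounds [|x - t j|]; the last 1 comes from the factor ['X]. *)
pose G := `|x| + 1 + 1.
have G0 : 0 <= G by rewrite !addr_ge0.
have qG n k : `|(q n)`_k| <= G ^+ n.
  apply: (@norm_coef_prod_XaddC (fun j => x - t j)) => j.
  by apply: le_trans (ler_normB _ _) _; rewrite lerD2l.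
pose c k n := y n / n`!%:R * (q n)`_k.
have M0 : 0 <= M by apply: le_trans (yM 0%N).
have cM k n : `|c k n| <= (M *: exp_coeff G) n.
  rewrite /c !normrM normfV normr_nat /exp_coeff fctE /= -mulrA.
  apply: ler_pM => //.
  by rewrite mulrC ler_wpM2r// invr_ge0.
have cvM : cvgn (series (M *: exp_coeff G)).
  by apply: is_cvg_seriesZ; exact: is_cvg_series_exp_coeff.
have M0n n : 0 <= (M *: exp_coeff G) n.
  by apply: mulr_ge0 => //; exact: exp_coeff_ge0.
exists (fun k => limn (series (c k))) => z; set h := z - x => h1.
pose P N := \sum_(n < N) (y n / n`!%:R) *: q n.
have PE N k : (P N)`_k = series (c k) N.
  rewrite coef_sum /series/= big_mkord; apply: eq_bigr => n _.
  by rewrite coefZ.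
apply: (@cvg_poly_cvg_pseries P _ (limn (series (M *: exp_coeff G)))) => //.
- move=> N k; rewrite PE /series/=; apply: le_trans (ler_norm_sum _ _ _) _.
  apply: le_trans (nondecreasing_cvgn_le _ cvM N); last first.
    by apply: nondecreasing_series => n _ _; exact: M0n.
  by rewrite /series/=; apply: ler_sum => i _; exact: cM.
- move=> k; under [X in X @ _ --> _]eq_fun do rewrite PE.
  apply: normed_cvg; apply: series_le_cvg cvM => // n; first exact: normr_ge0.
  exact: cM.
- have -> : (fun N => (P N).[h]) =
     series (fun n => y n / n`!%:R * \prod_(j < n) (z - t j)).
    apply/funext => N; rewrite horner_sum /series/= big_mkord.
    apply: eq_bigr => n _; rewrite hornerZ horner_prod; congr (_ * _).
    apply: eq_bigr => j _; by rewrite hornerD hornerX hornerC /h addrA subrK.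
  exact: fx.
Qed.

End analytic_criteria.

(** * Functionals bounded on bounded sets, and Mackey convergence *)

Section bornology.
Context {R : realType} {E : lmodType R} {D : dual_pair E}.
Implicit Types (A B : set E) (l : E -> R^o) (c : R -> E) (u : nat -> E).

Lemma bounded_imageP B l :
  bounded_set (l @` B : set R^o) <-> exists M, forall x, B x -> `|l x| <= M.
Proof.
split=> [[M [_ lM]]|[M lM]].
  exists (`|M| + 1) => x Bx; apply: (lM (`|M| + 1)); last by exists x.
  by rewrite (le_lt_trans (ler_norm M))// ltrDl.
exists M; split; first exact: num_real.
by move=> N /ltW MN _ [x Bx <-]; exact: le_trans (lM x Bx) MN.
Qed.

(** The class that contains [dual D] and also the dual of any other pair for which all [D]-bounded
    sets are bounded. *)
Definition bornological_functional l :=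
  scalar l /\ forall B, dual_bounded D B -> bounded_set (l @` B : set R^o).

Lemma dual_bornological l : dual D l -> bornological_functional l.
Proof. by move=> Dl; split; [exact: dual_scalar Dl|move=> B; apply]. Qed.

Lemma scalar_fun0 l : scalar l -> l 0 = 0.
Proof.
by move=> sl; have /eqP := sl 1 0 0;
  rewrite scaler0 addr0 mul1r -subr_eq subrr => /eqP.
Qed.

Lemma scalar_funZ l a x : scalar l -> l (a *: x) = a * l x.
Proof. by move=> sl; have := sl a x 0; rewrite (scalar_fun0 sl) !addr0. Qed.

Lemma scalar_funD l x y : scalar l -> l (x + y) = l x + l y.
Proof. by move=> sl; have := sl 1 x y; rewrite scale1r mul1r. Qed.

Lemma scalar_funB l x y : scalar l -> l (x - y) = l x - l y.
Proof.
by move=> sl; rewrite scalar_funD// -scaleN1r scalar_funZ// mulN1r.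
Qed.

Lemma scalar_fun_sum l n (F : nat -> E) : scalar l ->
  l (\sum_(i < n) F i) = \sum_(i < n) l (F i).
Proof.
move=> sl; elim: n => [|n IH]; first by rewrite !big_ord0 scalar_fun0.
by rewrite !big_ord_recr/= scalar_funD// IH.
Qed.

Lemma absolutely_convexZ A x (a : R) : absolutely_convex A -> A x ->
  `|a| <= 1 -> A (a *: x).
Proof.
move=> cA Ax a1; have := cA x x a 0 Ax Ax.
by rewrite scale0r addr0 normr0 addr0; apply.
Qed.

Lemma linear_spanZ A x (a : R) : A x -> linear_span A (a *: x).
Proof.
move=> Ax; have /submod_closedP[S0 SD] := linear_span_submod A.
by rewrite -[_ *: _]addr0; apply: SD => // S [_]; apply.
Qed.

(** Boundedness on the disk makes [l] continuous on its normed span, so limits there pass through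
    [l]. *)
Lemma norm_le_minkowski A l (M : R) x : absolutely_convex A -> scalar l ->
  0 < M -> (forall y, A y -> `|l y| <= M) -> linear_span A x ->
  `|l x| <= M * minkowski_functional A x.
Proof.
move=> cA sl M0 lM sx; have [->|gx] := linear_span_gauge cA sx.
  by rewrite scalar_fun0// minkowski_functional0// mulr0 normr0.
rewrite -ler_pdivrMl//; apply: minkowski_functional_glb => // t t0 [a Aa ->].
rewrite scalar_funZ// normrM (gtr0_norm t0) ler_pdivrMl// mulrC.
by rewrite ler_wpM2r ?lM// ltW.
Qed.

(* The limit is taken in the Banach space of a disk containing [B], hence is the
   same for all [l]. *)
Lemma mackey_cauchy_cvg B u : complete_dual_pair D -> dual_bounded D B ->
  (forall e : R, 0 < e -> exists N, forall m n, (N <= m)%N -> (N <= n)%N ->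
    exists2 b, B b & exists2 r : R, `|r| <= e & u m - u n = r *: b) ->
  exists z, forall l, bornological_functional l -> l (u n) @[n --> \oo] --> l z.
Proof.
move=> cD bB uB; have [A BA bA] := cD _ bB.
have cA := @disk_absolutely_convex _ _ _ A.
(* The value 1 is arbitrary: from [N] on, differences are multiples of points of [B], so
   [u (n + N) - u N] lies in the span of [A] even if [u n] does not. *)
have [N uN] := uB 1 ltr01.
have sv n : (u (n + N)%N - u N) \in linear_span A.
  have [b Bb [r _ ->]] := uN (n + N)%N N (leq_addl _ _) (leqnn _).
  by apply: mem_set; apply: linear_spanZ; exact: BA.
pose v n : disk_span A := Sub (u (n + N)%N - u N) (sv n).
have vE n : val (v n) = u (n + N)%N - u N by rewrite SubK.
have vC : cauchy (v @ \oo).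
  apply/cauchy_exP => e e0.
  have e20 : 0 < e / 2 by rewrite divr_gt0.
  have [N1 uN1] := uB (e / 2) e20.
  exists (v N1); exists N1 => // n /= N1n; rewrite -ball_normE/=.
  apply: (@le_lt_trans _ _ (e / 2)); last by rewrite ltr_pdivrMr// ltr_pMr// ltr1n.
  rewrite disk_span_normE; apply: minkowski_functional_lb => //.
  have -> : val (v N1 - v n) = u (N1 + N)%N - u (n + N)%N.
    transitivity (val (v N1) - val (v n)); first exact: raddfB.
    by rewrite !vE opprB addrA subrK.
  have [||b Bb [r re ->]] := uN1 (N1 + N)%N (n + N)%N.
  - exact: leq_addr.
  - by rewrite (leq_trans N1n)// leq_addr.
  exists ((r / (e / 2)) *: b); last by rewrite scalerA mulrC divfK// gt_eqF.
  apply: absolutely_convexZ => //; first exact: BA.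
  by rewrite normrM normfV (gtr0_norm e20) ler_pdivrMr// mul1r.
pose w := lim (v @ \oo); have vw : v @ \oo --> w by exact: bA vC.
exists (u N + val w) => l [sl lb].
have [M lM] := (bounded_imageP A l).1 (lb A (@disk_bounded _ _ _ A)).
pose K := `|M| + 1.
have K0 : 0 < K by rewrite ltr_wpDl.
have lK y : disk_set A y -> `|l y| <= K.
  by move=> Ay; rewrite (le_trans (lM y Ay))// (le_trans (ler_norm M))// lerDl.
rewrite -(cvg_shiftn N); apply/cvgrPdist_lt => e e0.
have eK : 0 < e / K by rewrite divr_gt0.
have /cvgrPdist_lt/(_ _ eK) := vw.
apply: filterS => n; rewrite disk_span_normE ltr_pdivlMr// mulrC.
have wv : val (w - v n) = val w - (u (n + N)%N - u N).
  by transitivity (val w - val (v n)); [exact: raddfB|rewrite vE].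
apply: le_lt_trans; have -> : l (u N + val w) - l (u (n + N)%N) = l (val (w - v n)).
  rewrite wv !scalar_funB// scalar_funD//.
  by rewrite opprB addrCA addrA.
apply: norm_le_minkowski => //; exact: set_mem (valP (w - v n)).
Qed.

End bornology.

Arguments bornological_functional {R E} D l.

(** * Derivatives of smooth curves in a complete dual pair *)

Section smooth_curves.
Context {R : realType} {E : lmodType R} {D : dual_pair E}.
Implicit Types (l : E -> R^o) (c : R -> E) (x t : R).

Definition difference_quotient c (x t : R) : E := t^-1 *: (c (x + t) - c x).

Lemma is_derive_lipschitz_quotient (f : R -> R) (x d M : R) :
  (forall t, 0 < `|t| <= 1 -> `|t^-1 * (f (x + t) - f x) - d| <= M * `|t|) ->
  is_derive x (1 : R) f d.
Proof.
move=> fd.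
have fcvg : h^-1 *: ((f \o shift x) (h *: (1 : R)) - f x) @[h --> 0^'] --> d.
  apply: cvg_zero; apply: (@cvg_to_0_linear _ _ M 1) => // r /andP[r0 r1].
  rewrite !fctE /= [r *: 1]mulr1 [r + x]addrC.
  by apply: fd; rewrite r0 ltW.
apply: DeriveDef; first by apply/cvg_ex; exists d.
exact: cvg_lim fcvg.
Qed.

(* Mackey convergence of the difference quotients: by the second order Taylor
   estimate they form a Lipschitz family with respect to a bounded set. *)
Lemma smooth_curve_derive_at c x : complete_dual_pair D -> smooth_curve D c ->
  exists z : E, forall l, bornological_functional D l ->
  is_derive x (1 : R) (l \o c : R -> R) (l z).
Proof.
move=> cD sc; pose q := difference_quotient c x.
pose unit_ball (t : R) := 0 < `|t| <= 1.
pose B : set E := [set b | exists t s, [/\ unit_ball t, unit_ball s &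
  b = (`|t| + `|s|)^-1 *: (q t - q s)]].
have ts0 t s : unit_ball t -> unit_ball s -> 0 < `|t| + `|s|.
  by move=> /andP[t0 _] /andP[s0 _]; rewrite addr_gt0.
have lq l t : scalar l -> l (q t) = t^-1 * (l (c (x + t)) - l (c x)).
  by move=> sl; rewrite /q /difference_quotient scalar_funZ// scalar_funB.
have bB : dual_bounded D B.
  move=> l Dl; have sl := dual_scalar Dl; apply/bounded_imageP.
  have [M fM] := smooth_taylor2 x (sc l Dl).
  exists M => _ [t [s [t1 s1 ->]]].
  have qM r : unit_ball r -> `|l (q r) - derive1 (l \o c) x| <= M * `|r|.
    move=> /andP[r0 r1]; rewrite lq//.
    have rn0 : r != 0 by rewrite -normr_gt0.
    rewrite -(ler_pM2l r0) -normrM mulrBr mulrA divff// mul1r.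
    by rewrite [r * _]mulrC mulrCA -expr2; exact: fM.
  rewrite scalar_funZ// normrM normfV [`|_ + _|]gtr0_norm ?ts0//.
  rewrite ler_pdivrMl ?ts0// scalar_funB//.
  have -> : l (q t) - l (q s) = (l (q t) - derive1 (l \o c) x) -
    (l (q s) - derive1 (l \o c) x) by rewrite opprB addrA subrK.
  apply: le_trans (ler_normB _ _) _; rewrite mulrC mulrDr.
  by apply: lerD; exact: qM.
have qB t s : unit_ball t -> unit_ball s ->
    exists2 b, B b & q t - q s = (`|t| + `|s|) *: b.
  move=> t1 s1; exists ((`|t| + `|s|)^-1 *: (q t - q s)); first by exists t, s.
  by rewrite scalerA divff ?scale1r// gt_eqF// ts0.
have un n : unit_ball (n.+1%:R^-1).
  by rewrite /unit_ball normfV normr_nat invr_gt0 ltr0n/= invf_le1// ler1n.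
have [|z uz] := @mackey_cauchy_cvg _ _ D B (fun n => q n.+1%:R^-1) cD bB.
  move=> e e0; have e20 : 0 < e / 2 by rewrite divr_gt0.
  have [N _ Ne] := near_infty_natSinv_lt (PosNum e20).
  exists N => m n Nm Nn; have [b Bb ->] := qB _ _ (un m) (un n).
  exists b => //; eexists; last by [].
  rewrite !normfV !normr_nat ger0_norm// [leRHS]splitr.
  by apply: lerD; apply: ltW; exact: Ne.
exists z => l lb; have [sl lB] := lb.
have [M lM] := (bounded_imageP B l).1 (lB B bB).
apply: (@is_derive_lipschitz_quotient _ _ _ M) => t t1.
rewrite /= -lq//.
(* Boundedness of [l] on [B] compares [q t] with [q (1 / (n + 1))]; letting [n] grow gives a rate
   for all small [t], not only along the sequence. *)
have lqt : l (q t) - l (q n.+1%:R^-1) @[n --> \oo] --> l (q t) - l z.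
  by apply: cvgB; [exact: cvg_cst|exact: uz].
have bound : M * (`|t| + `|n.+1%:R^-1|) @[n --> \oo] --> M * (`|t| + `|0 : R|).
  apply: cvgMr; apply: cvgD; first exact: cvg_cst.
  by apply: cvg_norm; exact: cvg_harmonic.
rewrite normr0 addr0 in bound.
apply: ler_cvg_to (cvg_norm lqt) bound _; apply: nearW => n.
have [b Bb qtn] := qB _ _ t1 (un n).
rewrite -scalar_funB// qtn scalar_funZ// normrM ger0_norm ?addr_ge0//.
by rewrite mulrC ler_wpM2r ?lM// addr_ge0.
Qed.

Lemma smooth_curve_derive c : complete_dual_pair D -> smooth_curve D c ->
  exists2 c', smooth_curve D c' &
  forall l, bornological_functional D l ->
  forall x : R, is_derive x (1 : R) (l \o c : R -> R) (l (c' x)).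
Proof.
move=> cD sc.
have /choice[c' cc'] := fun x => smooth_curve_derive_at x cD sc.
have dc l : bornological_functional D l -> derive1 (l \o c) = l \o c'.
  move=> lb; apply/funext => x; rewrite derive1E.
  by have [_ ->] := cc' x l lb.
exists c'; last by move=> l lb x; exact: cc'.
move=> l Dl; rewrite -dc; last exact: dual_bornological.
exact/smooth_derive1/sc.
Qed.

Lemma smooth_curve_iter_derive c : complete_dual_pair D -> smooth_curve D c ->
  exists cn : nat -> R -> E, forall l, bornological_functional D l ->
  forall n, derive1n n (l \o c) = l \o cn n /\
    forall x : R, derivable (l \o cn n : R -> R) x 1.
Proof.
move=> cD sc.
(* Curves are paired with their smoothness so that choice yields a map that can be iterated. *)
have next (p : {c | smooth_curve D c}) : exists p' : {c | smooth_curve D c},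
    forall l, bornological_functional D l ->
    forall x : R, is_derive x (1 : R) (l \o sval p : R -> R) (l (sval p' x)).
  have [c' sc' cc'] := smooth_curve_derive cD (svalP p).
  by exists (exist _ c' sc').
have {next}/choice[d dP] := next.
exists (fun n => sval (iter n d (exist _ c sc))) => l lb n.
split; last by move=> x; have [] := dP (iter n d (exist _ c sc)) l lb x.
elim: n => [//|n IH]; rewrite derive1nS IH; apply/funext => x; rewrite derive1E.
by have [_ ->] := dP (iter n d (exist _ c sc)) l lb x.
Qed.

Lemma bornological_smooth c l : complete_dual_pair D -> smooth_curve D c ->
  bornological_functional D l -> smooth_function (l \o c).
Proof.
move=> cD sc lb n x; have [cn cnP] := smooth_curve_iter_derive cD sc.
by have [-> ] := cnP l lb n; exact.
Qed.

End smooth_curves.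

(** * Real analyticity under functionals bounded on bounded sets *)

Section real_analytic_curves.
Context {R : realType} {E : lmodType R} {D : dual_pair E}.
Implicit Types (A B : set E) (l : E -> R^o) (c : R -> E) (x t M : R).

Lemma eventually_bounded (u : nat -> R) N K :
  (forall n, (N <= n)%N -> `|u n| <= K) -> exists M : R, forall n, `|u n| <= M.
Proof.
move=> uK; have K0 : 0 <= K by apply: le_trans (uK N _).
exists (K + \sum_(i < N) `|u i|) => n; have [Nn|nN] := leqP N n.
  by rewrite (le_trans (uK n Nn))// lerDl sumr_ge0.
rewrite (bigD1 (Ordinal nN))//= addrCA lerDl addr_ge0// sumr_ge0//.
Qed.

(* Were the Cauchy estimates to fail for [l \o c] near [x], suitably rescaled
   derivatives would form a bounded set on which [l] is unbounded. *)
Lemma bornological_real_analytic c l : complete_dual_pair D ->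
  real_analytic_curve D c -> bornological_functional D l ->
  real_analytic_function (l \o c).
Proof.
move=> cD ac lb; have [sl lB] := lb.
have sc : smooth_curve D c.
  by move=> l1 Dl1; apply/real_analytic_smooth/ac.
have [cn cnP] := smooth_curve_iter_derive cD sc.
apply: cauchy_estimate_real_analytic; first exact: bornological_smooth lb.
move=> x; apply: contrapT => nC.
have /choice[p pP] : forall m : nat, exists ny : nat * R,
    `|ny.2 - x| < m.+1%:R^-1 /\
    (m.+1%:R ^+ 2) ^+ ny.1.+1 * (ny.1)`!%:R < `|derive1n ny.1 (l \o c) ny.2|.
  move=> m; apply: contrapT => nm; apply: nC.
  exists (m.+1%:R ^+ 2); exists m.+1%:R^-1; first by rewrite invr_gt0.
  move=> n y ym; rewrite leNgt; apply/negP => ny; apply: nm.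
  by exists (n, y).
(* The scale lies between two rates. For large [m] a Cauchy estimate with constant at most [m + 1]
   keeps [|l1 (b m)|] below 1, while failure for [l] with constant [(m + 1) ^ 2] leaves [|l (b m)|]
   above [(m + 1) ^ (n + 1)], [n] being the chosen order. *)
pose w m : R := m.+1%:R ^+ (p m).1.+1 * ((p m).1)`!%:R.
have w0 m : 0 < w m by rewrite mulr_gt0 ?exprn_gt0// ltr0n fact_gt0.
pose b m := (w m)^-1 *: cn (p m).1 (p m).2.
have lbE l1 m : bornological_functional D l1 ->
    `|l1 (b m)| = (w m)^-1 * `|derive1n (p m).1 (l1 \o c) (p m).2|.
  move=> l1b; have [-> _] := cnP l1 l1b (p m).1.
  by rewrite /b scalar_funZ; [rewrite normrM gtr0_norm// invr_gt0|case: l1b].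
have bB : dual_bounded D (range b).
  move=> l1 Dl1; apply/bounded_imageP.
  have [C [d d0 Cd]] := real_analytic_cauchy_estimate x (ac l1 Dl1).
  (* Past [N], [m + 1] exceeds [|C|], which controls the growth, and [1 / d], which puts the chosen
     points in the ball of the estimate. *)
  have [N NC] : exists N : nat, `|C| + d^-1 < N%:R.
    by exists (Num.truncn (`|C| + d^-1)).+1; exact: truncnS_gt.
  have [|M lM] := @eventually_bounded (l1 \o b) N 1.
    move=> m Nm /=; rewrite lbE; last exact: dual_bornological.
    have mC : `|C| + d^-1 < m.+1%:R.
      by apply: lt_le_trans NC _; rewrite ler_nat ltnW.
    have d1 : 0 < d^-1 by rewrite invr_gt0.
    rewrite ler_pdivrMl// mulr1; apply: le_trans (Cd _ _ _) _.
      have [+ _] := pP m => /lt_le_trans; apply.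
      rewrite -[leRHS]invrK lef_pV2 ?posrE ?invr_gt0//.
      by apply: ltW; apply: le_lt_trans mC; rewrite lerDr.
    rewrite ler_wpM2r//; apply: le_trans (ler_norm _) _.
    rewrite normrX lerXn2r ?nnegrE//.
    by apply: ltW; apply: le_lt_trans mC; rewrite lerDl ltW.
  by exists M => _ [m _ <-]; exact: lM.
have [M lM] := (bounded_imageP _ l).1 (lB _ bB).
have [m mM] : exists m : nat, M < m%:R by exists (Num.truncn M).+1; exact: truncnS_gt.
have := lM (b m) (ex_intro2 _ _ m I erefl).
rewrite lbE// ler_pdivrMl// leNgt => /negP; apply.
have [_] := pP m; apply: le_lt_trans.
rewrite -exprM mulnC exprM expr2 -[leRHS]mulrA -/(w m) [leLHS]mulrC.
rewrite ler_wpM2r ?(ltW (w0 m))//; apply: le_trans (ltW mM) _.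
apply: (@le_trans _ _ m.+1%:R); first by rewrite ler_nat.
by rewrite exprS ler_peMr// exprn_ege1// ler1n.
Qed.

(** * Newton series with coefficients in a disk *)

Lemma absolutely_convex_sum A (k : nat -> R) (x : nat -> E) n :
  absolutely_convex A -> (forall i, A (x i)) ->
  exists2 a, A a & \sum_(i < n) k i *: x i = (\sum_(i < n) `|k i|) *: a.
Proof.
move=> cA Ax; elim: n => [|n [a Aa IH]].
  by exists (x 0%N) => //; rewrite !big_ord0 scale0r.
rewrite !big_ord_recr/= IH; set s := \sum_(i < n) `|k i|.
have s0 : 0 <= s by apply: sumr_ge0.
have [sk0|sk0] := eqVneq (s + `|k n|) 0.
  move/eqP: (sk0); rewrite paddr_eq0// normr_eq0 => /andP[/eqP -> /eqP ->].
  by exists a => //; rewrite !scale0r addr0 normr0 addr0 scale0r.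
have sk : 0 < s + `|k n| by rewrite lt_neqAle eq_sym sk0 addr_ge0.
exists ((s / (s + `|k n|)) *: a + (k n / (s + `|k n|)) *: x n).
  apply: cA => //; rewrite !normrM !normfV (ger0_norm s0) (gtr0_norm sk).
  by rewrite -mulrDl divff.
by rewrite scalerDr !scalerA ![(s + _) * _]mulrC !divfK.
Qed.

(** The Newton basis for nodes in [[0, 1]], a compact interval on which a smooth function stays
    bounded. *)
Definition newton_poly (n : nat) t : R := \prod_(j < n) (t - j.+1%:R^-1).

Lemma newton_poly_eq0 n k : (k < n)%N -> newton_poly n k.+1%:R^-1 = 0.
Proof.
by move=> kn; rewrite /newton_poly (bigD1 (Ordinal kn))//= subrr mul0r.
Qed.

Lemma newton_poly_neq0 n : newton_poly n n.+1%:R^-1 != 0.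
Proof.
apply/prodf_neq0 => j _; rewrite subr_eq0 (inj_eq invr_inj) eqr_nat eqSS.
by rewrite gtn_eqF.
Qed.

(** For [j < n <= k] both points lie below the node [1 / (j + 1)], so corresponding factors have the
    same sign. Thus earlier terms of the series can only help a lower bound at a node. *)
Lemma newton_poly_div_ge0 n k : (n <= k)%N ->
  0 <= newton_poly n k.+1%:R^-1 / newton_poly n n.+1%:R^-1.
Proof.
move=> nk; rewrite -prodf_div; apply: prodr_ge0 => j _.
rewrite -[leRHS]mulrNN -[X in _ * X]invrN !opprB divr_ge0// subr_ge0 lef_pV2 ?posrE// ler_nat ltnS.
  by rewrite (leq_trans _ nk)// ltnW.
by rewrite ltnW.
Qed.

Lemma norm_newton_poly n t : `|newton_poly n t| <= (`|t| + 1) ^+ n.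
Proof.
rewrite normr_prod -[X in _ ^+ X]card_ord -prodr_const.
apply: ler_prod => j _; rewrite normr_ge0/=; apply: le_trans (ler_normB _ _) _.
by rewrite lerD2l normfV normr_nat invf_le1// ler1n.
Qed.

(** The coefficients are dominated by the exponential series at [|t| + 1], and a tail is its
    absolute weight times a point of [A]; so the partial sums are Mackey-Cauchy. *)
Lemma newton_series_cvg A (x : nat -> E) t : complete_dual_pair D ->
  dual_bounded D A -> absolutely_convex A -> (forall n, A (x n)) ->
  exists z : E, forall l, bornological_functional D l ->
  l (\sum_(n < N) (newton_poly n t / n`!%:R) *: x n) @[N --> \oo] --> l z.
Proof.
move=> cD bA cA Ax; pose k n := newton_poly n t / n`!%:R.
have /cvg_ex[s ks] : cvgn (series (fun n => `|k n|)).
  apply: series_le_cvg (is_cvg_series_exp_coeff (`|t| + 1)) => n.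
  - exact: normr_ge0.
  - by rewrite exp_coeff_ge0// addr_ge0.
  - rewrite normrM normfV normr_nat ler_wpM2r ?invr_ge0//.
    exact: norm_newton_poly.
apply: mackey_cauchy_cvg cD bA _ => e e0.
have e20 : 0 < e / 2 by rewrite divr_gt0.
have /cvgrPdist_lt/(_ _ e20)[N _ Ns] := ks.
have tail m n : (N <= n)%N -> (n <= m)%N -> exists2 b, A b &
    exists2 r : R, `|r| <= e &
    \sum_(i < m) k i *: x i - \sum_(i < n) k i *: x i = r *: b.
  move=> Nn nm; have [a Aa aE] := @absolutely_convex_sum A
    (fun i => k (i + n)%N) (fun i => x (i + n)%N) (m - n) cA (fun i => Ax _).
  exists a => //; exists (\sum_(i < m - n) `|k (i + n)%N|); last first.
    rewrite -aE -!(big_mkord xpredT (fun i => k i *: x i)).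
    rewrite (big_cat_nat (leq0n n) nm)//= addrAC subrr add0r -{1}[n]add0n big_addn.
    by rewrite big_mkord.
  rewrite ger0_norm ?sumr_ge0//.
  have -> : \sum_(i < m - n) `|k (i + n)%N| =
      series (fun n => `|k n|) m - series (fun n => `|k n|) n.
    rewrite /series/= (big_cat_nat (leq0n n) nm)//= addrAC subrr add0r.
    by rewrite -[n in RHS]add0n big_addn big_mkord.
  apply: le_trans (ler_norm _) _; rewrite [leRHS]splitr.
  rewrite -[X in `|X|](subrKA s) -opprB addrC.
  apply: le_trans (ler_normB _ _) _.
  by apply: lerD; apply: ltW; apply: Ns => //=; exact: leq_trans nm.
exists N => m n Nm Nn; have [nm|mn] := leqP n m; first exact: tail.
have [b Ab [r re rE]] := tail n m Nm (ltnW mn).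
by exists b => //; exists (- r); rewrite ?normrN// scaleNr -rE opprB.
Qed.

(* Newton interpolation at the nodes [1 / k.+1]: at a node only finitely many
   terms survive, so that [l] can be evaluated there although it need not be
   continuous. *)
Lemma unbounded_real_analytic_curve B l : complete_dual_pair D ->
  dual_bounded D B -> scalar l -> ~ bounded_set (l @` B : set R^o) ->
  exists2 c, real_analytic_curve D c & forall k, k%:R <= l (c k.+1%:R^-1).
Proof.
move=> cD bB sl nlB; have [A BA _] := cD B bB.
have cA := @disk_absolutely_convex _ _ _ A.
have bA := @disk_bounded _ _ _ A.
(* Unboundedness on [B] supplies a value of larger modulus, which the balanced disk allows to be
   scaled to [v]. *)
have onto (v : R) : exists2 a, disk_set A a & l a = v.
  have [b Bb vb] : exists2 b, B b & `|v| < `|l b|.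
    apply: contrapT => nb; apply: nlB; apply/bounded_imageP; exists `|v| => y By.
    by rewrite leNgt; apply/negP => vy; apply: nb; exists y.
  have lb0 : l b != 0 by rewrite -normr_gt0; exact: le_lt_trans vb.
  exists ((v / l b) *: b); last by rewrite scalar_funZ// divfK.
  apply: absolutely_convexZ => //; first exact: BA.
  by rewrite normrM normfV ler_pdivrMr ?normr_gt0// mul1r ltW.
(* Chosen so that [l] of the [n]-th term at its own node [1 / (n + 1)] is exactly [n]. *)
pose v n : R := n%:R * n`!%:R / newton_poly n n.+1%:R^-1.
have /choice[x xP] : forall n, exists a, disk_set A a /\ l a = v n.
  by move=> n; have [a Aa la] := onto (v n); exists a.
have Ax n : disk_set A (x n) by have [] := xP n.
pose u t N := \sum_(n < N) (newton_poly n t / n`!%:R) *: x n.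
have /choice[c cP] := fun t => newton_series_cvg t cD bA cA Ax.
have lu l1 t N : scalar l1 ->
    l1 (u t N) = series (fun n => l1 (x n) / n`!%:R * newton_poly n t) N.
  move=> sl1; rewrite /u (scalar_fun_sum N (fun n => (newton_poly n t / n`!%:R) *: x n) sl1)
    /series/= big_mkord.
  by apply: eq_bigr => n _; rewrite scalar_funZ// mulrC mulrA mulrAC.
exists c => [l1 Dl1|k].
  have [M lM] := (bounded_imageP _ l1).1 (bA l1 Dl1).
  apply: (@newton_series_real_analytic _ (fun j => j.+1%:R^-1)
    (fun n => l1 (x n)) M) => [n|n|t].
  - by rewrite normfV normr_nat invf_le1// ler1n.
  - exact: lM.
  - have := cP t l1 (dual_bornological Dl1).
    by under [X in X @ _ --> _]eq_fun do rewrite (lu _ _ _ (dual_scalar Dl1)).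
(* The functionals of [dual D] see the partial sums become constant and separate points, so this is
   an identity in [E], to which [l] applies. *)
have -> : c k.+1%:R^-1 = u k.+1%:R^-1 k.+1.
  apply: contrapT => /(@dual_separates _ _ D)[l1 Dl1]; apply.
  have := cP k.+1%:R^-1 l1 (dual_bornological Dl1).
  move/(cvg_unique _); apply => //; apply: cvg_near_cst.
  exists k.+1 => // N /= kN; congr (l1 _).
  rewrite -/(u _ N) /u -!(big_mkord xpredT
    (fun n => (newton_poly n k.+1%:R^-1 / n`!%:R) *: x n)).
  rewrite (big_cat_nat (leq0n k.+1) kN)//= [X in _ + X]big_nat_cond [X in _ + X]big1 ?addr0// => i.
  by rewrite andbT => /andP[ki _]; rewrite newton_poly_eq0// mul0r scale0r.
(* The last term equals [k]; the earlier ones are nonnegative. *)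
rewrite lu// /series/= big_nat_recr//= -[leLHS]add0r lerD//.
  rewrite big_mkord; apply: sumr_ge0 => n _; have [_ ->] := xP n.
  have -> : v n / n`!%:R * newton_poly n k.+1%:R^-1 =
      n%:R * (newton_poly n k.+1%:R^-1 / newton_poly n n.+1%:R^-1).
    rewrite /v; field; rewrite newton_poly_neq0 pnatr_eq0 -lt0n fact_gt0//.
  by rewrite mulr_ge0// newton_poly_div_ge0// ltnW.
have [_ ->] := xP k; rewrite /v mulrAC divfK ?newton_poly_neq0//.
by rewrite mulfK// pnatr_eq0 -lt0n fact_gt0.
Qed.

End real_analytic_curves.

(** * Comparison of two dual pairs *)

(** A functional of [dual D2] unbounded on [B] would yield a curve whose composite with it is
    smooth, hence bounded on [[0, 1]], yet at least [k] at [1 / (k + 1)]. The hypothesis on curves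
    follows from equality of the smooth curves as well as of the real analytic ones. *)
Lemma dual_bounded_sub (R : realType) (E : lmodType R) (D1 D2 : dual_pair E)
    (B : set E) : complete_dual_pair D1 ->
  (forall c, real_analytic_curve D1 c -> smooth_curve D2 c) ->
  dual_bounded D1 B -> dual_bounded D2 B.
Proof.
move=> cD1 D12 bB l Dl; apply: contrapT => nlB.
have [c ac ck] := unbounded_real_analytic_curve cD1 bB (dual_scalar Dl) nlB.
have [M lM] := smooth_bounded 0 1 (D12 c ac l Dl).
have [k Mk] : exists k : nat, M < k%:R by exists (Num.truncn M).+1; exact: truncnS_gt.
have := lM k.+1%:R^-1; rewrite invr_ge0 ler0n invf_le1// ler1n => /(_ isT).
apply/negP; rewrite -ltNge; apply: lt_le_trans Mk _.
exact: le_trans (ck k) (ler_norm _).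
Qed.

Lemma bornological_dual (R : realType) (E : lmodType R) (D1 D2 : dual_pair E) l :
  (forall B, dual_bounded D1 B -> dual_bounded D2 B) ->
  dual D2 l -> bornological_functional D1 l.
Proof.
by move=> D12 Dl; split=> [|B bB]; [exact: dual_scalar Dl|exact: D12 Dl].
Qed.

Theorem lemma1p10 (R : realType) (E : lmodType R) (D1 D2 : dual_pair E)
    (cD1 : complete_dual_pair D1) (cD2 : complete_dual_pair D2) :
  [<-> (forall B : set E, dual_bounded D1 B <-> dual_bounded D2 B);
       (forall c : R -> E, smooth_curve D1 c <-> smooth_curve D2 c);
       (forall c : R -> E,
          real_analytic_curve D1 c <-> real_analytic_curve D2 c)].
Proof.
have smooth_of_bounded (D D' : dual_pair E) : complete_dual_pair D ->
    (forall B, dual_bounded D B -> dual_bounded D' B) ->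
    forall c, smooth_curve D c -> smooth_curve D' c.
  move=> cD DD' c sc l Dl.
  exact: bornological_smooth cD sc (bornological_dual DD' Dl).
have analytic_of_bounded (D D' : dual_pair E) : complete_dual_pair D ->
    (forall B, dual_bounded D B -> dual_bounded D' B) ->
    forall c, real_analytic_curve D c -> real_analytic_curve D' c.
  move=> cD DD' c ac l Dl.
  exact: bornological_real_analytic cD ac (bornological_dual DD' Dl).
have analytic_smooth (D : dual_pair E) c :
    real_analytic_curve D c -> smooth_curve D c.
  by move=> ac l Dl; exact: real_analytic_smooth (ac l Dl).
tfae.
- by move=> bP c; split; apply: smooth_of_bounded => // B /bP.
(* The passage goes through bounded sets: since real analytic curves are smooth, the smooth curves
   determine the bounded sets, and these the real analytic curves. *)
- move=> sP c; split; apply: analytic_of_bounded => // B;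
    by apply: dual_bounded_sub => // c' /analytic_smooth/sP.
- by move=> aP B; split; apply: dual_bounded_sub => // c /aP/analytic_smooth.
Qed.
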